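(* For the linear crossed octagonal-quadrilateral networks $Q_n$ ($n\ge 1$), the ratio of the degree-Kirchhoff index to the Gutman index satisfies $$\lim_{n\rightarrow\infty} \frac{Kf^{*}(Q_{n})}{Gut(Q_{n})}=\frac14.$$
   Context: Definition of $Q_n$ (for an integer $n\ge 1$). The linear crossed octagonal-quadrilateral network $Q_n$ is the simple undirected graph with the $8n+2$ vertices $1,2,\ldots,4n+1$ and $1',2',\ldots,(4n+1)'$, and exactly the following $18n+1$ edges: (i) $\{i,i+1\}$ and $\{i',(i+1)'\}$ for $1\le i\le 4n$; (ii) the crossing edges $\{i,(i+1)'\}$ and $\{i',i+1\}$ for $1\le i\le 4n$; (iii) the rungs $\{1,1'\}$, and $\{4k,(4k)'\}$ and $\{4k+1,(4k+1)'\}$ for $1\le k\le n$. Indices. For a simple connected graph $G$ with vertices $v_1,\ldots,v_N$, let $d_i$ be the degree of $v_i$, let $d_{ij}$ be the distance (length of a shortest path) between $v_i$ and $v_j$, and let $r_{ij}$ be the resistance distance, i.e. the effective resistance between $v_i$ and $v_j$ in the electrical network obtained from $G$ by placing a unit resistor on each edge. The Gutman index is $Gut(G)=\sum_{i<j} d_i d_j d_{ij}$ and the degree-Kirchhoff index is $Kf^*(G)=\sum_{i<j} d_i d_j r_{ij}$. *)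

(* Defs.v *)
From HB Require Import structures.
From mathcomp Require Import all_boot all_order all_algebra.
From mathcomp Require Import ring.
From mathcomp Require Import all_classical all_reals all_analysis.

Set Implicit Arguments.
Unset Strict Implicit.
Unset Printing Implicit Defensive.

Import Order.TTheory GRing.Theory Num.Theory.
Import numFieldNormedType.Exports.

Local Open Scope ring_scope.
Local Open Scope classical_set_scope.

(* A simple graph is given by its adjacency relation [e] (symmetric and
   irreflexive) on a finite type of vertices. *)

Definition degree (T : finType) (e : rel T) (x : T) : nat := #|[pred y | e x y]|.

Definition walk (T : finType) (e : rel T) (x y : T) (m : nat) : bool :=
  [exists p : m.-tuple T, path e x p && (last x p == y)].

(* The least length of a walk from [x] to [y].  The search is limited to
   lengths below [#|T|], which loses nothing since a shortest path repeats no
   vertex; the value is [#|T|] when [x] and [y] are not connected. *)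
Definition dist (T : finType) (e : rel T) (x y : T) : nat :=
  find (walk e x y) (iota 0 #|T|).

(* Unit resistor on each edge, unit current entering at [a] and leaving at [b]:
   by Ohm's law the current from [x] to [y] along an edge is [v x - v y], and
   Kirchhoff's current law prescribes the net current out of each vertex. *)
Definition unit_current_potential (R : realType) (T : finType) (e : rel T)
    (a b : T) (v : T -> R) : Prop :=
  forall x : T, \sum_(y | e x y) (v x - v y) = (x == a)%:R - (x == b)%:R.

(* The potential drop from [a] to [b] for a unit current.  It does not depend on
   the potential chosen (see [resistanceE]). *)
Definition resistance (R : realType) (T : finType) (e : rel T) (a b : T) : R :=
  get [set r | exists2 v : T -> R,
         unit_current_potential e a b v & r = v a - v b].

(* In the two indices, [enum_rank] numbers the vertices, so that each unordered
   pair of distinct vertices is counted once. *)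
Definition Gut (T : finType) (e : rel T) : nat :=
  (\sum_(x : T) \sum_(y : T | (enum_rank x < enum_rank y)%N)
     degree e x * degree e y * dist e x y)%N.

Definition Kf_star (R : realType) (T : finType) (e : rel T) : R :=
  \sum_(x : T) \sum_(y : T | (enum_rank x < enum_rank y)%N)
     (degree e x)%:R * (degree e y)%:R * resistance R e x y.

(* The vertex [(false, i)] is i+1 and the vertex [(true, i)] is (i+1)'. *)
Definition Qvertex (n : nat) : finType := (bool * 'I_(4 * n + 1))%type.

Definition Qlabel (n : nat) (x : Qvertex n) : nat := x.2.+1.

Definition has_rung (n i : nat) : bool :=
  (i == 1)%N ||
  [exists k : 'I_n.+1, (1 <= k)%N && ((i == 4 * k)%N || (i == 4 * k + 1)%N)].

Definition Qarc (n : nat) (x y : Qvertex n) : bool :=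
  [|| (x.1 == y.1) && (Qlabel y == (Qlabel x).+1),
      (x.1 != y.1) && (Qlabel y == (Qlabel x).+1)
    | [&& x.1 != y.1, Qlabel y == Qlabel x & has_rung n (Qlabel x)]].

Definition Q (n : nat) : rel (Qvertex n) := fun x y => Qarc x y || Qarc y x.

Lemma Q_sym (n : nat) : symmetric (@Q n).
Proof. by move=> x y; rewrite /Q orbC. Qed.

Lemma Q_irrefl (n : nat) : irreflexive (@Q n).
Proof. by move=> x; rewrite /Q /Qarc eqxx /= ltn_eqF. Qed.

Lemma unit_current_potential_drop (R : realType) (T : finType) (e : rel T)
    (a b : T) (v w : T -> R) :
  symmetric e -> unit_current_potential e a b v ->
  unit_current_potential e a b w -> v a - v b = w a - w b.
Proof.
move=> esym hv hw.
have drop (u : T -> R) : \sum_x u x * ((x == a)%:R - (x == b)%:R) = u a - u b.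
  have pick c : \sum_x u x * (x == c)%:R = u c.
    rewrite (bigD1 c) //= eqxx mulr1 big1 ?addr0 // => x /negbTE ->.
    exact: mulr0.
  by under eq_bigr do rewrite mulrBr; rewrite sumrB !pick.
have reciprocity (u u' : T -> R) :
    \sum_x u x * \sum_(y | e x y) (u' x - u' y) =
    \sum_x u' x * \sum_(y | e x y) (u x - u y).
  apply/eqP; rewrite -subr_eq0 -sumrB; apply/eqP.
  transitivity (\sum_x \sum_(y | e x y) (u y * u' x - u x * u' y)).
    apply: eq_bigr => x _; rewrite !mulr_sumr -sumrB; apply: eq_bigr => y _.
    ring.
  under eq_bigr do rewrite sumrB.
  rewrite sumrB [X in _ - X](exchange_big_dep xpredT) //=.
  apply/eqP; rewrite subr_eq0; apply/eqP; apply: eq_bigr => x _.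
  by apply: eq_big => y; rewrite // esym.
rewrite -drop -[RHS]drop.
under eq_bigr do rewrite -hw.
by rewrite reciprocity; apply: eq_bigr => x _; rewrite hv.
Qed.

Lemma resistanceE (R : realType) (T : finType) (e : rel T) (a b : T)
    (v : T -> R) :
  symmetric e -> unit_current_potential e a b v ->
  resistance R e a b = v a - v b.
Proof.
move=> esym hv; rewrite /resistance; case: xgetP => [r _ [w hw ->]|/(_ (v a - v b))].
  exact: unit_current_potential_drop esym hw hv.
by case; exists v.
Qed.

(* Main.v *)
Require Import Defs.
From mathcomp Require Import all_boot all_order all_algebra.
From mathcomp Require Import zify ring lra.
From mathcomp Require Import all_classical all_reals all_analysis.

Set Implicit Arguments.
Unset Strict Implicit.
Unset Printing Implicit Defensive.

Import Order.TTheory GRing.Theory Num.Theory.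
Import numFieldNormedType.Exports.

Local Open Scope ring_scope.
Local Open Scope classical_set_scope.

(** Resistance distance and graph distance in [Q n] are governed by the same
    quantity, the difference [gap] of the positions of the two vertices along
    the strip, up to bounded errors:

    - [dist] lies between [gap] and [gap + 2], since an edge changes the position
      by at most one, and any two vertices in consecutive positions are adjacent
      ([dist_ge_gap], [dist_le_gap]);

    - the resistance lies between [gap / 4] and [gap / 4 + 1], since consecutive
      positions are joined by four unit resistors in parallel, and the layers
      interact only locally ([resistance_gap]).

    So [resistance - dist / 4] is bounded by 1.  As the degrees are at most 5,
    [Kf_star - Gut / 4] is [O(n ^ 2)] ([Kf_star_Gut]), whereas [Gut] grows like
    [n ^ 3] because a typical pair of vertices is at distance of order [n]
    ([Gut_ge]).  The ratio therefore differs from 1/4 by [O(1 / n)].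

    The resistances come from an explicit potential.  The swap of the two layers
    is a symmetry of the graph, so a unit source at [a] splits into a part
    symmetric under the swap and an antisymmetric one.  The symmetric part sees
    a path, with potential [- gap / 8] for its half of the source.  For the antisymmetric part, the
    contributions of the two vertices of a neighbouring position cancel, so the
    Laplacian is diagonal and its solution is supported on the position of [a].
    The sum of the two is [pole], and the potential for a unit current from [a]
    to [b] is [pole a - pole b]. *)

(** * Differences of positions *)

Definition gap (i j : nat) : nat := (i - j + (j - i))%N.

Lemma gapxx i : gap i i = 0%N.
Proof. by rewrite /gap subnn. Qed.

Lemma gap_triangle i j k : (gap i k <= gap i j + gap j k)%N.
Proof. rewrite /gap; lia. Qed.

Lemma gapC i j : gap i j = gap j i.
Proof. exact: addnC. Qed.

Lemma gap_step i j : i != j ->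
  exists k, [/\ k <= maxn i j, gap i k = 1 & gap i j = (gap k j).+1]%N.
Proof.
rewrite /gap neq_ltn => /orP[ij|ji]; first by exists i.+1; split; lia.
by exists i.-1; split; lia.
Qed.

(** * Neighbours and degrees *)

Definition rung n (x : Qvertex n) : bool := has_rung n (Qlabel x).

(** Adjacency as a sum of mutually exclusive cases, so that sums over neighbours
    split term by term. *)
Lemma Q_adjacentE n (x y : Qvertex n) :
  Q x y = ((0 < x.2) && (y.2 == x.2.-1 :> nat) + (y.2 == x.2.+1 :> nat)
           + rung x && (y.1 != x.1) && (y.2 == x.2 :> nat))%N :> nat.
Proof.
case: x y => s i [u j]; rewrite /Q /Qarc /rung /Qlabel /= !eqSS.
rewrite [u == s]eq_sym.
have [->|] := eqVneq (j : nat) i.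
  by case: (has_rung _ _) (eqVneq s u) => [] [] /=; lia.
by case: (eqVneq s u) => /=; lia.
Qed.

Lemma sum_ord_pick (V : nmodType) N (G : nat -> V) m :
  \sum_(j < N) G j *+ (j == m :> nat) = G m *+ (m < N)%N.
Proof.
case: ltnP => [mN|Nm]; last first.
  by apply: big1 => j _; rewrite ltn_eqF ?mulr0n // (leq_trans _ Nm).
rewrite (bigD1 (Ordinal mN)) //= eqxx big1 ?addr0 // => j.
by rewrite -val_eqE /= => /negbTE->.
Qed.

(** All local computations below (degrees and Laplacians) are instances of this
    formula.  At an end of the strip, the multiplicity 0 discards the value of [F]
    at the missing neighbouring position. *)
Lemma sum_neighbours (V : nmodType) n (x : Qvertex n) (F : bool -> nat -> V) :
  \sum_(y | Q x y) F y.1 y.2 =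
    (F true x.2.-1 + F false x.2.-1) *+ (0 < x.2)%N
    + (F true x.2.+1 + F false x.2.+1) *+ (x.2 < 4 * n)%N
    + F (~~ x.1) x.2 *+ rung x.
Proof.
have layer (u : bool) : \sum_(j : 'I_(4 * n + 1)) F u j *+ Q x (u, j) =
    F u x.2.-1 *+ (0 < x.2)%N + F u x.2.+1 *+ (x.2 < 4 * n)%N
    + F u x.2 *+ (rung x && (u != x.1)).
  under eq_bigr do rewrite Q_adjacentE /= !mulrnDr.
  rewrite !big_split /=; congr (_ + _ + _).
  - under eq_bigr do rewrite andbC -mulnb mulrnA.
    rewrite sumrMnl sum_ord_pick; congr (_ *+ _).
    have := ltn_ord x.2; case: (ltnP x.2.-1) => //; lia.
  - by rewrite sum_ord_pick; congr (_ *+ _); lia.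
  - under eq_bigr do rewrite andbC -mulnb mulrnA.
    by rewrite sumrMnl sum_ord_pick ltn_ord.
rewrite big_mkcond.
under eq_bigr => y _.
  rewrite (_ : (if _ then _ else _) = F y.1 y.2 *+ Q x (y.1, y.2)); last first.
    by rewrite -surjective_pairing; case: ifP.
  over.
rewrite -(pair_bigA _ (fun (u : bool) (j : 'I_(4 * n + 1)) =>
  F u j *+ Q x (u, j))) /= big_bool !layer.
rewrite !mulrnDl.
case: x.1; rewrite ?andbT ?andbF ?eqxx /= ?mulr0n ?addr0.
  by rewrite addrA addrACA.
by rewrite addrAC addrACA.
Qed.

Lemma degree_sum n (x : Qvertex n) :
  degree (@Q n) x = (2 * (0 < x.2) + 2 * (x.2 < 4 * n) + rung x)%N.
Proof.
rewrite /degree -sum1_card (sum_neighbours (V := nat) x (fun _ _ => 1%N)).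
by case: (0 < x.2)%N (x.2 < 4 * n)%N (rung x) => [] [] [].
Qed.

Lemma degree_le5 n (x : Qvertex n) : (degree (@Q n) x <= 5)%N.
Proof. by rewrite degree_sum; lia. Qed.

Lemma degree_ge2 n (x : Qvertex n) : (0 < n)%N -> (2 <= degree (@Q n) x)%N.
Proof. by rewrite degree_sum; lia. Qed.

(** * Distances *)

Lemma walkS (T : finType) (e : rel T) x y z m :
  e x z -> walk e z y m -> walk e x y m.+1.
Proof.
move=> xz /existsP[p /andP[zp /eqP py]]; apply/existsP; exists (cons_tuple z p).
by rewrite /= xz zp py eqxx.
Qed.

Lemma walk0 (T : finType) (e : rel T) x : walk e x x 0.
Proof. by apply/existsP; exists [tuple]; rewrite /= eqxx. Qed.

(** For walks of length at least [#|T|], the bound comes from the cut-off in the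
    definition of [dist]. *)
Lemma dist_le_walk (T : finType) (e : rel T) x y m :
  walk e x y m -> (dist e x y <= m)%N.
Proof.
move=> w; rewrite /dist; case: (ltnP m #|T|) => [mT|]; last first.
  by apply: leq_trans; rewrite -[leqRHS](size_iota 0) find_size.
rewrite leqNgt; apply/negP => /(before_find 0%N).
by rewrite nth_iota // add0n w.
Qed.

Lemma dist_ge (T : finType) (e : rel T) x y k :
  (k <= #|T|)%N -> (forall m, walk e x y m -> (k <= m)%N) ->
  (k <= dist e x y)%N.
Proof.
move=> kT kw; rewrite /dist.
case: (boolP (has (walk e x y) (iota 0 #|T|))) => [h|/hasNfind->]; last first.
  by rewrite size_iota.
apply: kw; have := nth_find 0%N h; rewrite nth_iota ?add0n //.
by rewrite -[ltnRHS](size_iota 0) -has_find.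
Qed.

Lemma gap_Q n (x y : Qvertex n) : Q x y -> (gap x.2 y.2 <= 1)%N.
Proof. by move=> xy; have := Q_adjacentE x y; rewrite xy /gap; lia. Qed.

Lemma gap_walk n (x y : Qvertex n) m :
  walk (@Q n) x y m -> (gap x.2 y.2 <= m)%N.
Proof.
case/existsP => -[p /= /eqP <-] /andP[xp /eqP <-].
elim: p x xp => [|z p IHp] x /=; first by rewrite /gap; lia.
case/andP => /gap_Q xz /IHp zp; apply: leq_trans (gap_triangle _ z.2 _) _.
exact: leq_add xz zp.
Qed.

Lemma Q_step n (x y : Qvertex n) : gap x.2 y.2 = 1%N -> Q x y.
Proof. by have := Q_adjacentE x y; rewrite /gap; case: Q => //=; lia. Qed.

(** Walk one position at a time towards [y], on the layer of [y] from the first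
    step on. *)
Lemma walk_gap n (x y : Qvertex n) :
  x.2 != y.2 :> nat -> walk (@Q n) x y (gap x.2 y.2).
Proof.
have [m] := ubnP (gap x.2 y.2); elim: m x => // m IHm x lt_m neq.
have [g1|g1] := eqVneq (gap x.2 y.2) 1%N.
  by rewrite g1; apply: walkS (walk0 _ _); apply: Q_step.
have [k [k_max xk ky]] := gap_step neq.
have kN : (k < 4 * n + 1)%N.
  by apply: leq_ltn_trans k_max _; rewrite gtn_max !ltn_ord.
pose z : Qvertex n := (y.1, Ordinal kN).
have xz : gap x.2 z.2 = 1%N by [].
have zy : gap x.2 y.2 = (gap z.2 y.2).+1 by [].
rewrite zy; apply: walkS (Q_step xz) _; apply: IHm; first by move: lt_m; lia.
by move: g1; rewrite zy /gap; lia.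
Qed.

Lemma dist_ge_gap n (x y : Qvertex n) : (gap x.2 y.2 <= dist (@Q n) x y)%N.
Proof.
apply: dist_ge; last by move=> m; apply: gap_walk.
rewrite card_prod card_bool card_ord /gap.
by have := ltn_ord x.2; have := ltn_ord y.2; lia.
Qed.

(** The 2 is for the two vertices of a single position, which are joined through
    a neighbouring position when there is no rung. *)
Lemma dist_le_gap n (x y : Qvertex n) :
  (0 < n)%N -> (dist (@Q n) x y <= gap x.2 y.2 + 2)%N.
Proof.
move=> n_gt0; have [xy|neq] := eqVneq (x.2 : nat) y.2; last first.
  by apply: leq_trans (dist_le_walk (walk_gap neq)) (leq_addr _ _).
apply: leq_trans (leq_addl _ _); apply: dist_le_walk.
have [k [k_max xk]] : exists k, (k <= maxn x.2 1)%N /\ gap x.2 k = 1%N.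
  by case: (nat_of_ord x.2) => [|i]; [exists 1%N | exists i]; rewrite /gap; lia.
have kN : (k < 4 * n + 1)%N.
  by apply: leq_ltn_trans k_max _; rewrite gtn_max ltn_ord; lia.
apply: (@walkS _ _ _ _ (false, Ordinal kN)); first exact: Q_step.
by apply: walkS (walk0 _ _); apply: Q_step; rewrite -xy gapC.
Qed.

(** * Potentials and resistances *)

(** The Laplacian of [gap _ i] on the path [0, ..., m] is the sum of
    [- 2] at [i] and of [1] at each end; subtractions are moved across the
    equation. *)
Lemma gap_laplacian i k m : (0 < m)%N -> (i <= m)%N -> (k <= m)%N ->
  (gap k.-1 i * (0 < k) + gap k.+1 i * (k < m) + (k == 0) + (k == m) =
   gap k i * ((0 < k) + (k < m)) + 2 * (k == i))%N.
Proof.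
rewrite /gap => m0 im km.
case: (posnP k) => [->|k0]; case: (ltnP k m) => km'; case: (eqVneq k i) => ki;
  rewrite ?muln0 ?muln1 /=; lia.
Qed.

(** The eigenvalue of the Laplacian on functions supported on the position of [a]
    that take opposite values on the two layers: the rung counts twice, as it
    joins opposite values. *)
Definition conductance n (a : Qvertex n) : nat := (degree (@Q n) a + rung a)%N.

Definition side (s u : bool) : int := if u == s then 1 else -1.

(** The potential created by a unit source at [a], the current leaving at the ends
    of the strip; [u] and [k] are the layer and the position. *)
Definition pole (R : realType) n (a : Qvertex n) (u : bool) (k : nat) : R :=
  - (gap k a.2)%:R / 8
  + (k == a.2)%:R * (side a.1 u)%:~R / (2 * (conductance a)%:R).

(** The second term of the right-hand side, which is the current leaving at the
    ends, does not depend on [a]: it cancels in [pole a - pole b]. *)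
Lemma laplacian_pole (R : realType) n (a x : Qvertex n) : (0 < n)%N ->
  \sum_(y | Q x y) (pole R a x.1 x.2 - pole R a y.1 y.2) =
  (x == a)%:R - ((x.2 == 0 :> nat) + (x.2 == (4 * n)%N :> nat))%:R / 4.
Proof.
move=> n_gt0.
rewrite (sum_neighbours x (fun u k => pole R a x.1 x.2 - pole R a u k)).
have le4n (z : Qvertex n) : (z.2 <= 4 * n)%N.
  by have := ltn_ord z.2; lia.
have n4_gt0 : (0 < 4 * n)%N by rewrite muln_gt0.
have gapE : (gap x.2.-1 a.2)%:R * (0 < x.2)%N%:R
      + (gap x.2.+1 a.2)%:R * (x.2 < 4 * n)%N%:R
      + ((x.2 == 0 :> nat) + (x.2 == (4 * n)%N :> nat))%:R
    = (gap x.2 a.2)%:R * ((0 < x.2)%N%:R + (x.2 < 4 * n)%N%:R)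
      + 2 * (x.2 == a.2 :> nat)%:R :> R.
  by rewrite -[in RHS]natrD -!natrM -!natrD addnA gap_laplacian.
have c_neq0 : (conductance a)%:R != 0 :> R.
  by rewrite pnatr_eq0 -lt0n /conductance; have := degree_ge2 a n_gt0; lia.
(* The antisymmetric parts of the poles cancel over a whole position. *)
have layers k : pole R a true k + pole R a false k = - (gap k a.2)%:R / 4.
  by rewrite /pole /side; case: a.1 => /=; field.
have -> P : P - pole R a true x.2.-1 + (P - pole R a false x.2.-1) =
    2 * P + (gap x.2.-1 a.2)%:R / 4.
  by have := layers x.2.-1; lra.
have -> P : P - pole R a true x.2.+1 + (P - pole R a false x.2.+1) =
    2 * P + (gap x.2.+1 a.2)%:R / 4.
  by have := layers x.2.+1; lra.
have -> : pole R a x.1 x.2 - pole R a (~~ x.1) x.2 =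
    (x.2 == a.2 :> nat)%:R * (side a.1 x.1)%:~R / (conductance a)%:R.
  by rewrite /pole /side; case: a.1; case: x.1 => /=; field.
have xaE : (x == a)%:R
    = (x.2 == a.2 :> nat)%:R * (1 + (side a.1 x.1)%:~R) / 2 :> R.
  rewrite -pair_eqE /= /side -val_eqE /=.
  by case: (x.1 == a.1); case: (_ == _); rewrite /=; field.
rewrite xaE -[_ *+ (0 < _)%N]mulr_natr -[_ *+ (_ < 4 * n)%N]mulr_natr
  -[_ *+ rung x]mulr_natr /pole.
(* Both [conductance a] and the sum of the other side are degree counts at the
   position of [a]: the former is twice the latter. *)
have cE : (x.2 == a.2 :> nat)%:R * (side a.1 x.1)%:~R / (conductance a)%:R
      * ((0 < x.2)%N%:R + (x.2 < 4 * n)%N%:R + (rung x)%:R)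
    = (x.2 == a.2 :> nat)%:R * (side a.1 x.1)%:~R / 2 :> R.
  have [xa|] := eqVneq (x.2 : nat) a.2; last by rewrite !mul0r.
  have -> : (conductance a)%:R =
      2 * ((0 < x.2)%N%:R + (x.2 < 4 * n)%N%:R + (rung x)%:R) :> R.
    rewrite -!natrD -natrM; congr (_%:R).
    rewrite /conductance degree_sum /rung /Qlabel -xa; lia.
  have : (0 < x.2)%N%:R + (x.2 < 4 * n)%N%:R + (rung x)%:R != 0 :> R.
    by rewrite -!natrD pnatr_eq0; lia.
  by move=> ?; field.
move: gapE cE c_neq0.
move: (gap x.2 a.2)%:R (gap x.2.-1 a.2)%:R (gap x.2.+1 a.2)%:R => g gl gr.
move: (nat_of_bool (0 < x.2)%N)%:R (nat_of_bool (x.2 < 4 * n)%N)%:R => l r.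
move: (rung x)%:R (conductance a)%:R (side _ _)%:~R => w c s.
move: (nat_of_bool (x.2 == _))%:R ((_ + _)%:R) => d e gapE cE c_neq0.
transitivity ((gl * l + gr * r - g * (l + r)) / 4 + d * s / c * (l + r + w)).
  by field.
by rewrite cE -(addrK e (gl * l + _)) gapE; field.
Qed.

Lemma resistance_poles (R : realType) n (a b : Qvertex n) : (0 < n)%N ->
  resistance R (@Q n) a b =
  (pole R a a.1 a.2 - pole R b a.1 a.2) - (pole R a b.1 b.2 - pole R b b.1 b.2).
Proof.
move=> n_gt0.
apply: (@resistanceE R _ (@Q n) a b
         (fun y => pole R a y.1 y.2 - pole R b y.1 y.2)); first exact: Q_sym.
move=> x; transitivity (\sum_(y | Q x y) (pole R a x.1 x.2 - pole R a y.1 y.2)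
    - \sum_(y | Q x y) (pole R b x.1 x.2 - pole R b y.1 y.2)).
  by rewrite -sumrB; apply: eq_bigr => y _; ring.
rewrite !laplacian_pole //; ring.
Qed.

(** The difference is the antisymmetric part of the drop, at most twice
    [1 / (2 * conductance a)]. *)
Lemma pole_drop (R : realType) n (a : Qvertex n) u k : (0 < n)%N ->
  0 <= pole R a a.1 a.2 - pole R a u k - (gap k a.2)%:R / 8 <= 1 / 2.
Proof.
move=> n_gt0.
have c_ge2 : 2 <= (conductance a)%:R :> R.
  rewrite ler_nat /conductance.
  by apply: leq_trans (degree_ge2 a n_gt0) (leq_addr _ _).
rewrite /pole /side !eqxx gapxx /=; set c : R := (2 * _)^-1.
have c_gt0 : 0 < c by rewrite invr_gt0; lra.
have c_le : c <= 1 / 4 by rewrite div1r lef_pV2 ?posrE; lra.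
case: (u == a.1); case: (k == _) => /=; lra.
Qed.

Lemma resistance_gap (R : realType) n (a b : Qvertex n) : (0 < n)%N ->
  0 <= resistance R (@Q n) a b - (gap a.2 b.2)%:R / 4 <= 1.
Proof.
move=> n_gt0; rewrite resistance_poles //.
have := pole_drop R a b.1 b.2 n_gt0; have := pole_drop R b a.1 a.2 n_gt0.
rewrite gapC; lra.
Qed.

Lemma resistance_dist (R : realType) n (x y : Qvertex n) : (0 < n)%N ->
  `|resistance R (@Q n) x y - (dist (@Q n) x y)%:R / 4| <= 1.
Proof.
move=> n_gt0; have := resistance_gap R x y n_gt0.
have: (gap x.2 y.2)%:R <= (dist (@Q n) x y)%:R :> R.
  by rewrite ler_nat dist_ge_gap.
have: (dist (@Q n) x y)%:R <= (gap x.2 y.2)%:R + 2 :> R.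
  by rewrite -natrD ler_nat dist_le_gap.
move=> ? ? ?; rewrite ler_norml; lra.
Qed.

(** * Comparison of the two indices *)

Lemma Kf_star_Gut (R : realType) n : (0 < n)%N ->
  `|Kf_star R (@Q n) - (Gut (@Q n))%:R / 4| <= 25 * (#|Qvertex n| ^ 2)%:R.
Proof.
move=> n_gt0.
rewrite /Kf_star /Gut natr_sum mulr_suml -sumrB.
apply: (le_trans (ler_norm_sum _ _ _)).
have -> : 25 * (#|Qvertex n| ^ 2)%:R
    = \sum_(x : Qvertex n) \sum_(y : Qvertex n) 25 :> R.
  by rewrite !big_const !iter_addr_0 -mulrnA mulr_natr.
apply: ler_sum => x _.
rewrite natr_sum mulr_suml -sumrB; apply: (le_trans (ler_norm_sum _ _ _)).
rewrite big_mkcond; apply: ler_sum => y _; case: ifP => // _.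
rewrite 2!natrM -[X in _ - X]mulrA -mulrBr normrM -natrM normr_nat.
rewrite -[leRHS]mulr1; apply: ler_pM => //; last exact: resistance_dist.
by rewrite ler_nat (@leq_mul _ _ 5 5) ?degree_le5.
Qed.

(** Pair [j] with [j + m]: by the triangle inequality the two gaps from [i] add up
    to at least [m]. *)
Lemma sum_gap m N i : (m + m <= N)%N -> (m * m <= \sum_(j < N) gap i j)%N.
Proof.
move=> /subnKC <-; rewrite !big_split_ord /= -big_split /=.
apply: leq_trans (leq_addr _ _).
rewrite -{1}(card_ord m) -sum_nat_const; apply: leq_sum => j _.
rewrite /gap; lia.
Qed.

(** Frees the lower bound on [Gut] from the numbering of the vertices. *)
Lemma sum_pairs (T : finType) (f : T -> T -> nat) :
  (forall x y, f x y = f y x) -> (forall x, f x x = 0%N) ->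
  (\sum_x \sum_y f x y =
   2 * \sum_x \sum_(y | enum_rank x < enum_rank y) f x y)%N.
Proof.
move=> fC f0; rewrite mul2n -addnn.
transitivity (\sum_x (\sum_(y | (enum_rank x < enum_rank y)%N) f x y
                     + \sum_(y | (enum_rank y < enum_rank x)%N) f y x))%N.
  apply: eq_bigr => x _; rewrite (bigID (fun y => enum_rank x < enum_rank y)%N).
  congr addn; rewrite /= (bigD1 x) ?ltnn //= f0 add0n.
  apply: eq_big => [y|y _]; last exact: fC.
  by rewrite -leqNgt ltn_neqAle andbC val_eqE (inj_eq enum_rank_inj).
rewrite big_split /=; congr addn.
by rewrite (exchange_big_dep xpredT).
Qed.

Lemma Gut_ge n : (0 < n)%N -> (#|Qvertex n| * (8 * n * n) <= 2 * Gut (@Q n))%N.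
Proof.
move=> n_gt0.
have gap_pairs := @sum_pairs (Qvertex n) (fun x y => gap x.2 y.2)
  (fun x y => gapC x.2 y.2) (fun x => gapxx x.2).
apply: (@leq_trans (\sum_(x : Qvertex n) \sum_(y : Qvertex n) gap x.2 y.2)%N).
  rewrite -sum_nat_const; apply: leq_sum => x _.
  rewrite -(pair_bigA _ (fun (_ : bool) (j : 'I_(4 * n + 1)) => gap x.2 j)) /=.
  rewrite sum_nat_const card_bool.
  rewrite (_ : 8 * n * n = 2 * (2 * n * (2 * n)))%N; last lia.
  by rewrite leq_mul2l sum_gap //; lia.
rewrite gap_pairs leq_mul2l /=; apply: leq_sum => x _; apply: leq_sum => y _.
apply: leq_trans (dist_ge_gap x y) _; apply: leq_pmull.
have dx := degree_ge2 x n_gt0; have dy := degree_ge2 y n_gt0.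
by rewrite muln_gt0 !(leq_trans _ dx, leq_trans _ dy).
Qed.

(** With [N = 8 * n + 2] vertices, the bounds [25 * N ^ 2] on the difference and
    [N * (4 * n ^ 2)] on [Gut] give an error of at most [25 * N / (4 * n ^ 2)];
    the constant 125 follows from [N <= 10 * n] and [n + 1 <= 2 * n]. *)
Lemma ratio_error (R : realType) n : (0 < n)%N ->
  `|Kf_star R (@Q n) / (Gut (@Q n))%:R - 1 / 4| <= 125 / n.+1%:R.
Proof.
move=> n_gt0; have := Kf_star_Gut R n_gt0; have := Gut_ge n_gt0.
have -> : #|Qvertex n| = (8 * n + 2)%N.
  by rewrite card_prod card_bool card_ord; lia.
move: (Kf_star _ _) (Gut _) => K G G_ge K_le.
have G_gt0 : 0 < G%:R :> R by rewrite ltr0n; nia.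
have -> : K / G%:R - 1 / 4 = (K - G%:R / 4) / G%:R by field; lra.
rewrite normrM normfV (ger0_norm (ltW G_gt0)) ler_pdivrMr //.
apply: le_trans K_le _.
rewrite mulrAC ler_pdivlMr ?ltr0n // -!natrM ler_nat; nia.
Qed.

Theorem theorem4p3 (R : realType) :
  (fun n : nat => Kf_star R (@Q n) / (Gut (@Q n))%:R) @ \oo --> (1 / 4 : R).
Proof.
apply/subr_cvg0/norm_cvg0P.
have bound : (fun n => 125 / n.+1%:R : R) @ \oo --> (0 : R).
  rewrite -[X in _ --> X](mulr0 125); apply: cvgM; first exact: cvg_cst.
  exact: cvg_harmonic.
apply: (squeeze_cvgr _ (cvg_cst 0) bound).
near=> n; rewrite normr_ge0 ratio_error //.
by near: n; exact: nbhs_infty_gt.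
Unshelve. all: by end_near. Qed.
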